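(* Let $H:\mathbb{R}^{2m}\to\mathbb{R}$ be smooth, let $\bar\nabla_sH$ be a symmetric discrete gradient of $H$, and let $\bar y\in\mathbb{R}^{2m}$. The numerical scheme $$y_{n+1}-y_n=\theta_n\,S\,\bar\nabla_sH(y_n,y_{n+1}),\qquad \theta_n=2(F')^{-1}\tanh\frac{h_nF'}{2},$$ where $F'=S\,H_{yy}$ is evaluated at $y=\bar y$ and $h_n>0$ is sufficiently small that $\tanh\frac{h_nF'}{2}$ is defined, is energy-preserving, i.e. $H(y_{n+1})=H(y_n)$ whenever $y_n,y_{n+1}$ satisfy the scheme. (Here $\bar y$ may be any point, possibly depending on $y_n,y_{n+1}$.)
   Context: Here $y=(x,p)^T\in\mathbb{R}^{2m}$ are canonical coordinates, $S=\begin{pmatrix}0&I\\-I&0\end{pmatrix}$, $H_{yy}$ is the Hessian of $H$, and $F'=SH_{yy}$ is the Jacobi matrix of the right-hand side $F=SH_y$ of Hamilton's equations $\dot x=H_p$, $\dot p=-H_x$. The expression $2(F')^{-1}\tanh\frac{h_nF'}{2}$ is understood as $h_n\operatorname{tanhc}\frac{h_nF'}{2}$ with $\operatorname{tanhc}(z)=z^{-1}\tanh z$, $\operatorname{tanhc}(0)=1$, so it makes sense also for singular $F'$. Discrete gradient: a function $\bar\nabla H(y_n,y_{n+1})\in\mathbb{R}^{2m}$ (treated as a column vector) such that $\langle\bar\nabla H(y_n,y_{n+1}),\,y_{n+1}-y_n\rangle=H(y_{n+1})-H(y_n)$ and $\bar\nabla H(y,y)=H_y(y)$ (the latter value being defined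 as the limit $\lim_{\tilde y\to y}\bar\nabla H(y,\tilde y)$ when necessary). The symmetric discrete gradient related to a discrete gradient $\bar\nabla H$ is $\bar\nabla_sH(y_n,y_{n+1})=\frac12\bigl(\bar\nabla H(y_n,y_{n+1})+\bar\nabla H(y_{n+1},y_n)\bigr)$. *)

(* Defs.v *)
From mathcomp Require Import all_boot all_order all_algebra.
From mathcomp Require Import all_classical all_reals all_analysis.

Set Implicit Arguments.
Unset Strict Implicit.
Unset Printing Implicit Defensive.
Import Order.TTheory GRing.Theory Num.Theory.
Import numFieldNormedType.Exports.
Local Open Scope classical_set_scope.
Local Open Scope ring_scope.

Section Calculus.
Context {R : realType} {n : nat}.
Implicit Type f : 'cV[R]_n -> R.

Definition partial f (i : 'I_n) : 'cV[R]_n -> R := 'D_(delta_mx i 0) f.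

Fixpoint is_Ck (k : nat) f : Prop :=
  match k with
  | 0 => continuous f
  | k'.+1 => forall i, (forall y, derivable f y (delta_mx i 0)) /\
                       is_Ck k' (partial f i)
  end.

Definition smooth f : Prop := forall k, is_Ck k f.

Definition grad f (y : 'cV[R]_n) : 'cV[R]_n := \col_i partial f i y.

Definition hessian f (y : 'cV[R]_n) : 'M[R]_n :=
  \matrix_(i, j) partial (partial f i) j y.

Definition dot (u v : 'cV[R]_n) : R := \sum_i u i 0 * v i 0.

(* D is total: where a formula for D is only given by a limit (for instance on
   the diagonal), D denotes the extended function. *)
Definition discrete_gradient f (D : 'cV[R]_n -> 'cV[R]_n -> 'cV[R]_n) : Prop :=
  (forall y y', dot (D y y') (y' - y) = f y' - f y) /\
  (forall y, D y y = grad f y).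

Definition symmetric_discrete_gradient f
    (Ds : 'cV[R]_n -> 'cV[R]_n -> 'cV[R]_n) : Prop :=
  exists2 D, discrete_gradient f D &
    forall y y', Ds y y' = 2^-1 *: (D y y' + D y' y).

End Calculus.

Section MatrixTanh.
Context {R : realType} {n : nat}.
Implicit Type A : 'M[R]_n.

Definition cosh_mx A : 'M[R]_n :=
  limn (series (fun k => (((2 * k)`!)%:R : R)^-1 *: A ^+ (2 * k))).

(* the entire function sinh z / z, with value 1 at 0 *)
Definition sinhc_mx A : 'M[R]_n :=
  limn (series (fun k => (((2 * k).+1`!)%:R : R)^-1 *: A ^+ (2 * k))).

(* tanh = sinh / cosh is defined at A iff cosh A is invertible, i.e. iff no
   complex eigenvalue of A is a pole of tanh. *)
Definition tanh_mx_defined A : Prop := cosh_mx A \in unitmx.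

(* tanhc z = tanh z / z = (sinh z / z) / cosh z; A itself may be singular. *)
Definition tanhc_mx A : 'M[R]_n := sinhc_mx A *m invmx (cosh_mx A).

End MatrixTanh.

Section Hamiltonian.
Context {R : realType} {m : nat}.

(* y = (x, p) in R^(2 m), with x the first m coordinates *)
Definition symplectic : 'M[R]_(m + m) := block_mx 0 1%:M (- 1%:M) 0.

Definition jacobi_mx (H : 'cV[R]_(m + m) -> R) (y : 'cV[R]_(m + m)) :
  'M[R]_(m + m) := symplectic *m hessian H y.

(* 2 F'^-1 tanh (h F' / 2), read as h tanhc (h F' / 2) *)
Definition theta (h : R) (F' : 'M[R]_(m + m)) : 'M[R]_(m + m) :=
  h *: tanhc_mx ((h / 2) *: F').

Definition scheme (H : 'cV[R]_(m + m) -> R)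
    (Ds : 'cV[R]_(m + m) -> 'cV[R]_(m + m) -> 'cV[R]_(m + m))
    (h : R) (ybar yn yn1 : 'cV[R]_(m + m)) : Prop :=
  yn1 - yn = theta h (jacobi_mx H ybar) *m symplectic *m Ds yn yn1.

End Hamiltonian.

(* Main.v *)
Require Import Defs.
From HB Require Import structures.
From mathcomp Require Import all_boot all_order all_algebra.
From mathcomp Require Import all_classical all_reals all_analysis.
From mathcomp Require Import ring.
Import Order.TTheory GRing.Theory Num.Theory.
Import numFieldNormedType.Exports.
Local Open Scope classical_set_scope.
Local Open Scope ring_scope.

(** The scheme has the form [y' - y = M g] with [M = theta S] and [g] the
    symmetric discrete gradient at [(y, y')].  Averaging a discrete gradient
    over the two orders of its arguments keeps the mean value identity, so
    [H y' - H y = dot g (y' - y) = dot g (M g)]; this vanishes as soon as [M] is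
    skew-symmetric ([dot_skew]), whatever [g] is.

    Skewness of [M] ([theta_symplectic_skew]) is where the Hamiltonian form
    enters.  Let [A = (h / 2) S K] with [K] the Hessian.  As [K] is symmetric and
    [S] skew, [A S = - S A^T]: multiplication by [S] exchanges [A] and [- A^T].
    Hence it exchanges [A ^+ 2] and its transpose, and the same holds for every
    convergent power series in [A ^+ 2], such as [cosh A] and [sinhc A], and
    for the quotient [tanhc A], because [cosh A] and [sinhc A] commute.  So
    [tanhc A S = S (tanhc A)^T = - (tanhc A S)^T].

    Two analytic facts support this algebra.  The Hessian is symmetric by
    Schwarz's theorem ([schwarz]), proved here for directional derivatives by
    applying the mean value theorem twice to a second difference.  The matrix
    series converge because their coefficients are bounded by those of the
    exponential, and linear identities satisfied by all powers pass to their
    sums ([linear_mx_pseries_eq0]). *)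

(** * Symmetry of second derivatives *)

Section Schwarz.
Context {R : realType} {V : normedModType R}.
Implicit Types (f : V -> R) (u v y : V).

(** The difference quotient of the restriction of [f] to a line is literally a
    directional difference quotient of [f]. *)
Lemma is_derive_line {W : normedModType R} (f : V -> W) y v (t : R) :
  derivable f (y + t *: v) v ->
  is_derive t 1 (fun s : R => f (y + s *: v)) ('D_v f (y + t *: v)).
Proof.
move=> fv.
have E : (fun h : R => h^-1 *: (((fun s : R => f (y + s *: v)) \o shift t)
             (h *: (1 : R)) - f (y + t *: v))) =
         (fun h : R => h^-1 *: ((f \o shift (y + t *: v)) (h *: v) -
             f (y + t *: v))).
  apply/funext => h /=.
  by rewrite scalerDl [h *: 1]mulr1 addrCA.
by split; rewrite /derivable /derive E.
Qed.

Lemma mvt_line f y v (t : R) : 0 < t -> (forall z, derivable f z v) ->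
  exists2 s, 0 < s < t & f (y + t *: v) - f y = t * 'D_v f (y + s *: v).
Proof.
move=> t0 fv; pose g (s : R) := f (y + s *: v).
have gd (s : R) : is_derive s 1 g ('D_v f (y + s *: v)) by exact: is_derive_line.
have gC := @derivable_within_continuous _ _ _ `[0, t]
  (fun s _ => @ex_derive _ _ _ _ _ _ _ (gd s)).
have [s] := @MVT R g (fun s => 'D_v f (y + s *: v)) 0 t t0 (fun s _ => gd s) gC.
rewrite in_itv /= => st; rewrite /g scale0r addr0 subr0 => ->.
by exists s => //; rewrite mulrC.
Qed.

(** The left-hand side is symmetric in [u] and [v] while the right-hand side
    differentiates along [u] first: this asymmetry is what yields [schwarz].
    The mean value theorem is applied along [u] to [z |-> f (z + t v) - f z],
    then along [v] to ['D_u f]. *)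
Lemma second_difference f y u v (t : R) : 0 < t ->
  (forall z, derivable f z u) -> (forall z, derivable ('D_u f) z v) ->
  exists a b : R, [/\ 0 < a < t, 0 < b < t &
    f (y + t *: u + t *: v) - f (y + t *: u) - f (y + t *: v) + f y =
    t ^+ 2 * 'D_v ('D_u f) (y + (a *: u + b *: v))].
Proof.
move=> t0 fu fuv.
pose g z := f (z + t *: v) - f z.
have gu z : is_derive z u g ('D_u f (z + t *: v) - 'D_u f z).
  apply: is_deriveB; last exact/derivableP.
  have E : (fun h : R => h^-1 *: (((fun z => f (z + t *: v)) \o shift z)
             (h *: u) - f (z + t *: v))) =
         (fun h : R => h^-1 *: ((f \o shift (z + t *: v)) (h *: u) -
             f (z + t *: v))) by apply/funext => h /=; rewrite addrA.
  by split; rewrite /derivable /derive E //; exact: fu.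
have [a at_ Ea] :=
  @mvt_line g y u t t0 (fun z => @ex_derive _ _ _ _ _ _ _ (gu z)).
have [b bt Eb] := @mvt_line ('D_u f) (y + a *: u) v t t0 fuv.
exists a, b; split; [exact: at_|exact: bt|].
have -> : f (y + t *: u + t *: v) - f (y + t *: u) - f (y + t *: v) + f y =
   g (y + t *: u) - g y by rewrite /g; ring.
by rewrite Ea (@derive_val _ _ _ _ _ _ _ (gu _)) Eb addrA; ring.
Qed.

(** The second difference over a small parallelogram equals [t ^+ 2] times
    either mixed derivative, each taken at some point of the parallelogram; by
    continuity both values are close to the values at [y]. *)
Lemma schwarz f y u v :
  (forall z, derivable f z u) -> (forall z, derivable f z v) ->
  (forall z, derivable ('D_u f) z v) -> (forall z, derivable ('D_v f) z u) ->
  {for y, continuous ('D_v ('D_u f))} -> {for y, continuous ('D_u ('D_v f))} ->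
  'D_v ('D_u f) y = 'D_u ('D_v f) y.
Proof.
move=> fu fv fuv fvu cuv cvu; apply/eqP; rewrite -subr_eq0 -normr_le0.
apply/ler_addgt0Pl => e e0; rewrite addr0.
have e20 : 0 < e / 2 by rewrite divr_gt0.
have /cvgrPdist_lt /(_ _ e20) /nbhs_ballP [d1 /= d10 H1] := cuv.
have /cvgrPdist_lt /(_ _ e20) /nbhs_ballP [d2 /= d20 H2] := cvu.
pose d := Num.min d1 d2.
have d0 : 0 < d by rewrite lt_min d10 d20.
(* The sides [t u] and [t v] are so short that the whole parallelogram lies
   within [d] of [y]; the extra 1 keeps [t] positive when [u = v = 0]. *)
have K0 : 0 < `|u| + `|v| + 1 by rewrite ltr_wpDl // addr_ge0.
pose t := d / (`|u| + `|v| + 1).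
have t0 : 0 < t by rewrite divr_gt0.
have near_y (a b : R) : 0 < a < t -> 0 < b < t -> `|a *: u + b *: v| < d.
  move=> /andP[a0 a1] /andP[b0 b1].
  have -> : d = t * (`|u| + `|v| + 1) by rewrite /t divfK // gt_eqF.
  rewrite (le_lt_trans (ler_normD _ _)) // !normrZ !gtr0_norm //.
  rewrite !mulrDr mulr1 (@le_lt_trans _ _ (t * `|u| + t * `|v|)) ?ltrDl //.
  by rewrite lerD // ler_wpM2r // ltW.
have [a [b [ha hb E1]]] := second_difference f y u v t t0 fu fuv.
have [b' [a' [hb' ha' E2]]] := second_difference f y v u t t0 fv fvu.
have E : 'D_v ('D_u f) (y + (a *: u + b *: v)) =
         'D_u ('D_v f) (y + (a' *: u + b' *: v)).
  apply: (@mulfI _ (t ^+ 2)); first by rewrite expf_neq0 // gt_eqF.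
  rewrite [a' *: u + _]addrC.
  apply: (etrans (esym E1)); apply: etrans E2; congr (_ + _).
  by rewrite [y + t *: v + t *: u]addrAC [RHS]addrAC.
have B1 : ball y d1 (y + (a *: u + b *: v)).
  rewrite -ball_normE /= opprD addNKr normrN.
  apply: (lt_le_trans (near_y _ _ ha hb)).
  rewrite ge_min.
  rewrite lexx.
  reflexivity.
have B2 : ball y d2 (y + (a' *: u + b' *: v)).
  rewrite -ball_normE /= opprD addNKr normrN.
  apply: (lt_le_trans (near_y _ _ ha' hb')).
  by rewrite ge_min lexx orbT.
have {H1} := H1 _ B1; have {H2} := H2 _ B2; rewrite /= -E => H2 H1.
apply: le_trans (ler_distD _ _ _) _; rewrite [leRHS]splitr; apply: ltW.
by apply: ltrD; [exact: H1|rewrite distrC; exact: H2].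
Qed.

End Schwarz.

Lemma hessian_sym (R : realType) n (f : 'cV[R]_n -> R) y :
  smooth f -> (hessian f y)^T = hessian f y.
Proof.
move=> fS; apply/matrixP => i j; rewrite !mxE.
have d1 k z : derivable f z (delta_mx k 0) by have [] := fS 1%N k.
have d2 k l z : derivable (partial f k) z (delta_mx l 0).
  by have [_ /(_ l)[]] := fS 2%N k.
have c2 k l : continuous (partial (partial f k) l).
  by have [_ /(_ l)[]] := fS 2%N k.
by apply: schwarz; [exact: d1|exact: d1|exact: d2|exact: d2|exact: c2|exact: c2].
Qed.

(** * Power series of matrices *)

Section MatrixSeries.
Context {R : realType}.

Lemma coord_le_norm m n (A : 'M[R]_(m, n)) i j : `|A i j| <= `|A|.
Proof.
rewrite [leRHS]/Num.Def.normr /= mx_normrE.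
exact: (le_bigmax (0 : R) (fun ij : 'I_m * 'I_n => `|A ij.1 ij.2|) (i, j)).
Qed.

Lemma norm_mulmx_le m n p (A : 'M[R]_(m, n)) (B : 'M[R]_(n, p)) :
  `|A *m B| <= n%:R * `|A| * `|B|.
Proof.
rewrite [leLHS]/Num.Def.normr /= mx_normrE; apply: bigmax_le => [|[i j] _ /=].
  by rewrite !mulr_ge0.
rewrite mxE (le_trans (ler_norm_sum _ _ _)) // -mulrA mulr_natl.
have -> : `|A| * `|B| *+ n = \sum_(k < n) `|A| * `|B|.
  by rewrite sumr_const card_ord.
rewrite ler_sum // => k _.
by rewrite normrM ler_pM // coord_le_norm.
Qed.

Lemma norm_mx1_le n : `|1%:M : 'M[R]_n| <= 1.
Proof.
rewrite [leLHS]/Num.Def.normr /= mx_normrE; apply: bigmax_le => // -[i j] _ /=.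
by rewrite mxE; case: (i == j); rewrite ?normr1 ?normr0.
Qed.

Lemma norm_mxX_le n (A : 'M[R]_n) k : `|A ^+ k| <= (n%:R * `|A|) ^+ k.
Proof.
elim: k => [|k IH]; first exact: norm_mx1_le.
rewrite !exprS (le_trans (norm_mulmx_le _ _ _ _ _)) //.
by rewrite ler_wpM2l // mulr_ge0.
Qed.

(** A linear map on matrices is a finite combination of the entries. *)
Lemma linear_mx_continuous m n (V : normedModType R)
  (f : {linear 'M[R]_(m, n) -> V}) : continuous f.
Proof.
have -> : f = (fun A => \sum_i \sum_j A i j *: f (delta_mx i j)) :> (_ -> _).
  apply/funext => A; rewrite {1}[A]matrix_sum_delta linear_sum.
  apply: eq_bigr => i _; rewrite linear_sum; apply: eq_bigr => j _.
  by rewrite linearZ.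
move=> A; have FA : Filter (nbhs A) by exact: nbhs_filter.
have cvgD (I : Type) := @cvg_big V I +%R 0 xpredT add_continuous _ (nbhs A).
apply: (cvgD _ _ _ _ FA) => i _; apply: (cvgD _ _ _ _ FA) => j _.
by apply: cvgZr_tmp; exact: coord_continuous.
Qed.

(* Joins the completeness and the norm of matrices into a single structure, so
   that absolute convergence of a matrix series implies convergence. *)
HB.instance Definition _ m n := Complete.on 'M[R]_(m, n).

Definition mx_pseries (c : nat -> R) n (B : 'M[R]_n) : 'M[R]_n :=
  limn (series (fun k => c k *: B ^+ k)).

Definition exp_dominated (c : nat -> R) := forall k, `|c k| <= (k`!%:R)^-1.

(** Comparison with the exponential series at [n * `|B|]; the factor [n] makes
    the entrywise maximum norm submultiplicative. *)
Lemma is_cvg_mx_pseries c n (B : 'M[R]_n) : exp_dominated c ->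
  cvgn (series (fun k => c k *: B ^+ k)).
Proof.
move=> cB; apply: normed_cvg; apply: series_le_cvg;
  last exact: (is_cvg_series_exp_coeff (n%:R * `|B|)) => //.
- by move=> k; rewrite /= normr_ge0.
- by move=> k; rewrite exp_coeff_ge0 // mulr_ge0.
- move=> k /=; rewrite normrZ mulrC /exp_coeff /= ler_pM //.
  exact: norm_mxX_le.
Qed.

(** Transfers to the sum any linear relation valid for all powers, such as
    commuting with a matrix or being exchanged with its transpose. *)
Lemma linear_mx_pseries_eq0 n (V : normedModType R) (f : {linear 'M[R]_n -> V})
    c (B : 'M[R]_n) : exp_dominated c ->
  (forall k, f (B ^+ k) = 0) -> f (mx_pseries c n B) = 0.
Proof.
move=> cB fB.
have cv : f (series (fun k => c k *: B ^+ k) N) @[N --> \oo] -->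
          f (mx_pseries c n B).
  apply: continuous_cvg; first exact: linear_mx_continuous.
  exact: is_cvg_mx_pseries.
apply: (cvg_unique _ cv); first exact: norm_hausdorff.
have -> : (fun N => f (series (fun k => c k *: B ^+ k) N)) = (fun=> 0).
  apply/funext => N; rewrite /series /= linear_sum big1 // => k _.
  by rewrite linearZ /= fB scaler0.
exact: cvg_cst.
Qed.

Lemma comm_mx_pseries c n (A B : 'M[R]_n) : exp_dominated c ->
  A *m B = B *m A -> A *m mx_pseries c n B = mx_pseries c n B *m A.
Proof.
move=> cB AB; apply/eqP; rewrite -subr_eq0; apply/eqP.
apply: (@linear_mx_pseries_eq0 _ _ (mulmx A \- mulmxr A)) => // k /=.
by apply/eqP; rewrite subr_eq0; apply/eqP/commrX.
Qed.

Lemma tr_intertwine_mx_pseries c n (B S : 'M[R]_n) : exp_dominated c ->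
  B *m S = S *m B^T -> mx_pseries c n B *m S = S *m (mx_pseries c n B)^T.
Proof.
move=> cB BS; apply/eqP; rewrite -subr_eq0; apply/eqP.
apply: (@linear_mx_pseries_eq0 _ _ (mulmxr S \- (mulmx S \o trmx))) => // k /=.
apply/eqP; rewrite subr_eq0; apply/eqP.
elim: k => [|k IH]; first by rewrite expr0 trmx1 mul1mx mulmx1.
rewrite {1}exprS exprSr -[_ * _]/(_ *m _) -[X in X^T]/(_ *m _).
by rewrite -mulmxA IH mulmxA BS -mulmxA trmx_mul.
Qed.

End MatrixSeries.

(** * The hyperbolic functions of a matrix *)

Section MatrixTanh.
Context {R : realType} {n : nat}.
Implicit Types A S : 'M[R]_n.

Definition cosh_coeff (k : nat) : R := ((2 * k)`!%:R)^-1.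
Definition sinhc_coeff (k : nat) : R := ((2 * k).+1`!%:R)^-1.

Lemma exp_dominated_inv_fact (g : nat -> nat) :
  (forall k, (k <= g k)%N) -> exp_dominated (fun k => (((g k)`!)%:R)^-1 : R).
Proof.
move=> kg k; rewrite normfV normr_nat lef_pV2 ?posrE ?ltr0n ?fact_gt0 //.
by rewrite ler_nat leq_fact.
Qed.

Lemma cosh_coeff_dominated : exp_dominated cosh_coeff.
Proof. by apply: exp_dominated_inv_fact => k; rewrite leq_pmull. Qed.

Lemma sinhc_coeff_dominated : exp_dominated sinhc_coeff.
Proof. by apply: exp_dominated_inv_fact => k; rewrite leqW // leq_pmull. Qed.

Lemma cosh_mxE A : cosh_mx A = mx_pseries cosh_coeff n (A ^+ 2).
Proof. by rewrite /mx_pseries; under eq_fun do rewrite -exprM. Qed.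

Lemma sinhc_mxE A : sinhc_mx A = mx_pseries sinhc_coeff n (A ^+ 2).
Proof. by rewrite /mx_pseries; under eq_fun do rewrite -exprM. Qed.

Lemma sinhc_cosh_comm A : sinhc_mx A *m cosh_mx A = cosh_mx A *m sinhc_mx A.
Proof.
rewrite cosh_mxE sinhc_mxE; apply: comm_mx_pseries.
  exact: cosh_coeff_dominated.
by rewrite -comm_mx_pseries //; exact: sinhc_coeff_dominated.
Qed.

(** The two signs cancel in the square, so the relation with a plus sign passes
    to even power series in [A]. *)
Lemma tr_intertwine_sqr A S : A *m S = - (S *m A^T) ->
  A ^+ 2 *m S = S *m (A ^+ 2)^T.
Proof.
move=> AS; rewrite expr2 -[_ * _]/(_ *m _) trmx_mul.
by rewrite -mulmxA AS mulmxN mulmxA AS mulNmx opprK mulmxA.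
Qed.

(** The relation [X S = S X^T] holds for [cosh A] and [sinhc A], hence for the
    inverse of the former; transposing the product reverses its two factors,
    and their commutation restores the order. *)
Lemma tr_intertwine_tanhc A S : tanh_mx_defined A -> A *m S = - (S *m A^T) ->
  tanhc_mx A *m S = S *m (tanhc_mx A)^T.
Proof.
rewrite /tanh_mx_defined /tanhc_mx => Cu /tr_intertwine_sqr A2S.
have CS : cosh_mx A *m S = S *m (cosh_mx A)^T.
  by rewrite cosh_mxE; apply: tr_intertwine_mx_pseries A2S;
    exact: cosh_coeff_dominated.
have ShS : sinhc_mx A *m S = S *m (sinhc_mx A)^T.
  by rewrite sinhc_mxE; apply: tr_intertwine_mx_pseries A2S;
    exact: sinhc_coeff_dominated.
have VS : invmx (cosh_mx A) *m S = S *m (invmx (cosh_mx A))^T.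
  apply: (can_inj (mulKmx Cu)); rewrite mulKVmx // mulmxA CS -mulmxA.
  by rewrite -trmx_mul mulVmx // trmx1 mulmx1.
have VSh : invmx (cosh_mx A) *m sinhc_mx A = sinhc_mx A *m invmx (cosh_mx A).
  apply: (can_inj (mulKmx Cu)); rewrite mulKVmx // mulmxA -sinhc_cosh_comm.
  by rewrite mulmxK.
by rewrite -{2}VSh -mulmxA VS mulmxA ShS -mulmxA -trmx_mul.
Qed.

End MatrixTanh.

(** * Energy preservation *)

Lemma dotE (R : realType) n (u v : 'cV[R]_n) : dot u v = (u^T *m v) 0 0.
Proof. by rewrite mxE; apply: eq_bigr => i _; rewrite mxE. Qed.

(** A scalar equals its own transpose, here also its own opposite. *)
Lemma dot_skew (R : realType) n (M : 'M[R]_n) (u : 'cV[R]_n) :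
  M^T = - M -> dot u (M *m u) = 0.
Proof.
move=> MN; rewrite dotE; set B := _ *m _.
have BN : B^T = - B by rewrite /B !trmx_mul trmxK MN mulmxN mulNmx mulmxA.
have : B^T 0 0 = (- B) 0 0 by rewrite BN.
by rewrite !mxE => /eqP; rewrite eq_sym eqNr => /eqP.
Qed.

(** Swapping [y] and [y'] changes the sign of both sides of the mean value
    identity, so the two halves of the average contribute equally. *)
Lemma symmetric_discrete_gradient_mean (R : realType) n (f : 'cV[R]_n -> R) Ds :
  symmetric_discrete_gradient f Ds ->
  forall y y', dot (Ds y y') (y' - y) = f y' - f y.
Proof.
move=> [D [fD _] DsE] y y'.
have dotDZ (a : R) (u v w : 'cV[R]_n) :
    dot (a *: (u + v)) w = a * (dot u w + dot v w).
  by rewrite !dotE linearZ linearD /= -scalemxAl mulmxDl !mxE.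
have dotN (u w : 'cV[R]_n) : dot u (- w) = - dot u w.
  by rewrite !dotE mulmxN mxE.
rewrite DsE dotDZ fD -[y' - y]opprB dotN fD opprB.
by field.
Qed.

Lemma symplectic_tr (R : realType) m :
  (@symplectic R m)^T = - symplectic.
Proof.
rewrite /symplectic tr_block_mx opp_block_mx !trmx0 !linearN /=.
by rewrite trmx1 opprK oppr0.
Qed.

(** For [A = (h / 2) S K] with [K^T = K] and [S^T = - S], both [A S] and
    [- S A^T] equal [(h / 2) S K S]. *)
Lemma theta_symplectic_skew (R : realType) m (h : R) (K : 'M[R]_(m + m)) :
  K^T = K -> tanh_mx_defined ((h / 2) *: (symplectic *m K)) ->
  (theta h (symplectic *m K) *m symplectic)^T =
  - (theta h (symplectic *m K) *m symplectic).
Proof.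
move=> KT def; set A := _ *: _ in def.
have AS : A *m symplectic = - (symplectic *m A^T).
  rewrite /A linearZ /= trmx_mul KT symplectic_tr mulmxN scalerN mulmxN opprK.
  by rewrite -scalemxAl -scalemxAr mulmxA.
rewrite /theta -/A trmx_mul symplectic_tr linearZ /= mulNmx -scalemxAr.
by rewrite -scalemxAl tr_intertwine_tanhc.
Qed.

Theorem proposition4p10 (R : realType) (m : nat) (H : 'cV[R]_(m + m) -> R)
    (Ds : 'cV[R]_(m + m) -> 'cV[R]_(m + m) -> 'cV[R]_(m + m))
    (ybar : 'cV[R]_(m + m)) (h : R)
    (hH : smooth H) (hDs : symmetric_discrete_gradient H Ds)
    (h_gt0 : 0 < h)
    (h_small : tanh_mx_defined ((h / 2) *: jacobi_mx H ybar)) :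
  forall yn yn1 : 'cV[R]_(m + m), scheme H Ds h ybar yn yn1 -> H yn1 = H yn.
Proof.
move=> yn yn1 step; apply/eqP; rewrite -subr_eq0.
rewrite -(symmetric_discrete_gradient_mean _ _ _ _ hDs) step; apply/eqP.
apply: dot_skew; apply: theta_symplectic_skew => //.
exact: hessian_sym.
Qed.
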